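(* Let $m\geq 3$ be an integer and $\mathbb{F}_{2^m}^*=\mathbb{F}_{2^m}\setminus\{0\}$. For $3\leq k\leq 2^m-4$ let $W_k=\{B\subseteq \mathbb{F}_{2^m}^* : |B|=k,\ \sum_{x\in B}x=0\}$, let $b_k=|W_k|$, and let $r_k$ be the number of blocks of $W_k$ containing a given point of $\mathbb{F}_{2^m}^*$ (this number does not depend on the point, since $(\mathbb{F}_{2^m}^*,W_k)$ is a balanced incomplete block design). Set $r_{2^m-3}:=0$. Then for $3\leq k\leq 2^m-4$, $$r_{k+1}=\begin{cases} b_k-r_k, & k\equiv 1,3\pmod 4,\\ b_k-r_k+\binom{2^{m-1}-1}{k/2}, & k\equiv 2\pmod 4,\\ b_k-r_k-\binom{2^{m-1}-1}{k/2}, & k\equiv 0\pmod 4.\end{cases}$$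
   Context: $\mathbb{F}_{2^m}$ denotes the finite field with $2^m$ elements. For $3\le k\le 2^m-4$, every pair of distinct points of $\mathbb{F}_{2^m}^*$ lies in the same number $\lambda_k$ of blocks of $W_k$, and consequently every point lies in the same number $r_k=\lambda_k(2^m-2)/(k-1)$ of blocks. *)

(* Defs.v *)
From HB Require Import structures.
From mathcomp Require Import all_boot all_order all_algebra all_field.

Set Implicit Arguments.
Unset Strict Implicit.
Unset Printing Implicit Defensive.

Import GRing.Theory.
Local Open Scope ring_scope.

Definition punctured (F : finFieldType) : {set F} := [set~ 0].

Definition W (F : finFieldType) (k : nat) : {set {set F}} :=
  [set B : {set F} | [&& B \subset punctured F, #|B| == k &
                         \sum_(x in B) x == 0]].

Definition b (F : finFieldType) (k : nat) : nat := #|W F k|.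

(* The number of blocks through the point x, meant for x != 0; the first branch
   is the boundary convention r_{2^m - 3} := 0, with 2^m = #|F|. *)
Definition r (F : finFieldType) (k : nat) (x : F) : nat :=
  if (k == #|F| - 3)%N then 0%N else #|[set B in W F k | x \in B]|.

(* Main.v *)
Require Import Defs.
From HB Require Import structures.
From mathcomp Require Import all_boot all_order all_fingroup all_algebra all_field.
From mathcomp Require Import zify.

(** Fix a point [x <> 0] and let [E] be the complement of [{0, x}].  Removing
    [x] from the blocks through [x] shows that [r_{k+1}] counts the [k]-subsets
    of [E] with sum [x], while [b_k - r_k] counts those with sum [0].  The
    translation [z |-> z + x] is a fixed point free involution of [E], whose
    orbits are pairs with sum [x].  If [A] is not a union of pairs, exchanging
    the two points of the first pair split by [A] changes the sum of [A] by [x],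
    so such sets contribute equally to both counts.  A union of [j] pairs has
    [2j] points and sum [j x], and there are [C(2^(m-1) - 1, j)] of these. *)

Set Implicit Arguments.
Unset Strict Implicit.
Unset Printing Implicit Defensive.

Import GRing.Theory.
Local Open Scope ring_scope.

Section TranslationPairs.

Variables (F : finFieldType) (x : F).
Hypotheses (char2 : 2 \in [pchar F]) (x0 : x != 0).

(** * Split pairs and the exchange involution *)

Definition offpair : {set F} := ~: [set 0; x].

Definition offsets (k : nat) (c : F) : {set {set F}} :=
  [set A : {set F} | [&& A \subset offpair, #|A| == k & \sum_(z in A) z == c]].

Definition split_points (A : {set F}) : {set F} :=
  [set z | (z \in A) != (z + x \in A)].

(** The fallback to [A] itself makes the map an involution on all sets, unions of pairs included. *)
Definition swap_first (A : {set F}) : {set F} :=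
  if [pick y in split_points A] is Some y then tperm y (y + x) @: A else A.

Lemma addxx2 (z : F) : z + z = 0.
Proof. exact: addrr_pchar2. Qed.

Lemma addxK2 (z : F) : z + x + x = z.
Proof. by rewrite -addrA addxx2 addr0. Qed.

Lemma addx_neq (z : F) : z + x != z.
Proof. by rewrite -subr_eq0 addrAC subrr add0r. Qed.

Lemma offpair_addx (z : F) : (z + x \in offpair) = (z \in offpair).
Proof.
rewrite !inE -[X in _ || (_ == X)]add0r (inj_eq (addIr x)) orbC.
by rewrite -[X in _ || (_ == X)](addxx2 x) (inj_eq (addIr x)).
Qed.

(** The transposition exchanges the two points of one translation orbit and fixes every other orbit
    pointwise. This is what makes being split invariant under the exchange. *)
Lemma tperm_addx (y z : F) :
  tperm y (y + x) (z + x) = tperm y (y + x) z + x.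
Proof.
have [->|zy] := eqVneq z y; first by rewrite tpermR tpermL addxK2.
have [->|zyx] := eqVneq z (y + x); first by rewrite addxK2 tpermL tpermR.
rewrite !tpermD // 1?eq_sym //.
- by apply: contraNneq zyx => <-; rewrite addxK2.
- by rewrite (inj_eq (addIr x)).
Qed.

Lemma mem_tperm_imset (y z : F) (A : {set F}) :
  (z \in tperm y (y + x) @: A) = (tperm y (y + x) z \in A).
Proof. by rewrite -{1}(tpermK y (y + x) z) mem_imset //; apply: perm_inj. Qed.

Lemma split_points_tperm (y : F) (A : {set F}) :
  split_points (tperm y (y + x) @: A) = split_points A.
Proof.
apply/setP=> z; rewrite [LHS]inE !mem_tperm_imset tperm_addx.
by case: tpermP => [->|->|_ _]; rewrite ?inE ?addxK2 // eq_sym.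
Qed.

Lemma split_points_swap A : split_points (swap_first A) = split_points A.
Proof. by rewrite /swap_first; case: pickP => // y _; apply: split_points_tperm. Qed.

(* The swapped pair depends only on [split_points A], which swapping preserves. *)
Lemma swap_firstK : involutive swap_first.
Proof.
move=> A; rewrite {1}/swap_first split_points_swap /swap_first.
case: pickP => // y _; rewrite -imset_comp -[RHS]imset_id.
by apply: eq_imset => z /=; rewrite tpermK.
Qed.

(** Exactly one of [y] and [y + x] lies in [A]. Trading it for the other changes the sum by [x] or
    by [- x], which agree in characteristic 2. *)
Lemma sum_tperm_split y (A : {set F}) : y \in split_points A ->
  \sum_(z in tperm y (y + x) @: A) z = \sum_(z in A) z + x.
Proof.
have swap u v : u \in A -> v \notin A ->
    \sum_(z in tperm u v @: A) z = \sum_(z in A) z + (v - u).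
  move=> uA vA; rewrite big_imset /=; last by move=> ? ? _ _; apply: perm_inj.
  rewrite (big_setD1 u) //= [in RHS](big_setD1 u) //= tpermL.
  rewrite (eq_bigr id) /= => [|z]; first by rewrite addrAC addrC subrKC addrC.
  rewrite !inE => /andP[zu zA]; rewrite tpermD // 1?eq_sym //.
  by apply: contraNneq vA => <-.
rewrite inE; case: (boolP (y \in A)) => yA; case: (boolP (y + x \in A)) => yxA //= _.
- by rewrite swap // [y + x]addrC addrK.
- by rewrite tpermC swap // opprD (addrA y) subrr add0r oppr_pchar2.
Qed.

Lemma swap_first_offsets k c A : split_points A != set0 ->
  A \in offsets k c -> swap_first A \in offsets k (c + x).
Proof.
case/set0Pn=> z0 z0A; rewrite !inE => /and3P[sA /eqP cA /eqP sumA].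
rewrite /swap_first; case: pickP => [y yA|/(_ z0)]; last by rewrite z0A.
rewrite card_imset ?cA ?eqxx; last exact: perm_inj.
rewrite sum_tperm_split // sumA eqxx !andbT.
apply/subsetP=> z; rewrite mem_tperm_imset.
by case: tpermP => [->|->|_ _] /(subsetP sA) //; rewrite offpair_addx.
Qed.

Definition split_offsets k c := [set A in offsets k c | split_points A != set0].
Definition balanced_offsets k c := [set A in offsets k c | split_points A == set0].

(** The exchange is injective and shifts the sum by [x]. Starting from sum 0 and from sum [x] gives
    the two inequalities, since [x + x = 0]. *)
Lemma card_split_offsets k : #|split_offsets k x| = #|split_offsets k 0|.
Proof.
have le c : (#|split_offsets k c| <= #|split_offsets k (c + x)%R|)%N.
  rewrite -(card_imset _ (inv_inj swap_firstK)); apply: subset_leq_card.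
  apply/subsetP=> _ /imsetP[A /setIdP[Ac AU] ->].
  by rewrite inE swap_first_offsets // split_points_swap.
by apply/eqP; rewrite eqn_leq; have := le x; have := le 0; rewrite addxx2 add0r => -> ->.
Qed.

Lemma card_offsets k c :
  #|offsets k c| = (#|split_offsets k c| + #|balanced_offsets k c|)%N.
Proof.
rewrite addnC -(cardsID [set A | split_points A == set0] (offsets k c)).
by congr (_ + _)%N; apply: eq_card => A; rewrite !inE // andbC.
Qed.

(** * Translation orbits and the sets that are unions of orbits *)

Definition tpair (z : F) : {set F} := [set z; z + x].
Definition tpairs : {set {set F}} := tpair @: offpair.

Lemma tpair_addx z : tpair (z + x) = tpair z.
Proof. by rewrite /tpair addxK2 setUC. Qed.

Lemma mem_tpair y z : y \in tpair z -> tpair y = tpair z.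
Proof. by rewrite !inE => /orP[]/eqP-> //; apply: tpair_addx. Qed.

Lemma card_tpair z : #|tpair z| = 2.
Proof. by rewrite cards2 eq_sym addx_neq. Qed.

Lemma sum_tpair z : \sum_(y in tpair z) y = x.
Proof.
rewrite big_setU1 ?big_set1 /=; first by rewrite addrA addxx2 add0r.
by rewrite inE eq_sym addx_neq.
Qed.

Lemma trivIset_tpairs : trivIset tpairs.
Proof.
apply/trivIsetP=> _ _ /imsetP[y _ ->] /imsetP[z _ ->]; apply: contraR.
by case/pred0Pn=> u /= /andP[/mem_tpair <- /mem_tpair <-].
Qed.

Lemma cover_tpairs : cover tpairs = offpair.
Proof.
apply/setP=> z; apply/bigcupP/idP => [[_ /imsetP[y yE ->]]|zE].
- by case/set2P=> ->; rewrite ?offpair_addx.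
- by exists (tpair z); [apply: imset_f | rewrite set21].
Qed.

Lemma trivIset_sub_tpairs (Q : {set {set F}}) : Q \subset tpairs -> trivIset Q.
Proof. by move/trivIsetS; apply; apply: trivIset_tpairs. Qed.

Lemma card_cover_tpairs (Q : {set {set F}}) : Q \subset tpairs ->
  #|cover Q| = (#|Q| * 2)%N.
Proof.
move=> QP; have /eqP <- := trivIset_sub_tpairs QP.
rewrite -sum_nat_const; apply: eq_bigr => B /(subsetP QP) /imsetP[z _ ->].
exact: card_tpair.
Qed.

Lemma sum_cover_tpairs (Q : {set {set F}}) : Q \subset tpairs ->
  \sum_(z in cover Q) z = x *+ #|Q|.
Proof.
move=> QP; rewrite big_trivIset ?trivIset_sub_tpairs //= -sumr_const.
by apply: eq_bigr => B /(subsetP QP) /imsetP[z _ ->]; apply: sum_tpair.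
Qed.

Lemma card_tpairs : #|tpairs| = (#|F| %/ 2 - 1)%N.
Proof.
have := card_cover_tpairs (subxx tpairs); rewrite cover_tpairs => cE.
have := cardsC [set 0; x]; rewrite -/offpair cE cards2 eq_sym x0 /=.
(* The field consists of the two points 0 and [x] together with the disjoint pairs, so halving its
   order counts one more than the pairs. *)
by move=> <-; rewrite addnC divnMDl // addnK.
Qed.

(** Since distinct pairs are disjoint, a family of pairs can be recovered from its union. Hence
    unions of pairs may be counted by their families. *)
Lemma cover_tpairs_inj (Q : {set {set F}}) : Q \subset tpairs ->
  Q = [set B in tpairs | B \subset cover Q].
Proof.
move=> QP; apply/setP=> B; rewrite inE; apply/idP/andP => [BQ|[/imsetP[z _ ->]]].
  by split; [apply: (subsetP QP) | apply: bigcup_sup].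
move/subsetP/(_ z (set21 _ _)) => /bigcupP[B' B'Q].
by have [u _ defB'] := imsetP (subsetP QP _ B'Q); rewrite defB' in B'Q * => /mem_tpair ->.
Qed.

(** Without split points [A] is closed under translation, so it is the union of the pairs of its own
    points. *)
Lemma balanced_cover (A : {set F}) : A \subset offpair -> split_points A == set0 ->
  exists2 Q : {set {set F}}, Q \subset tpairs & A = cover Q.
Proof.
move=> AE /eqP bA; exists [set tpair z | z in A]; first exact: imsetS.
have AS z : (z + x \in A) = (z \in A).
  by move/setP/(_ z): bA; rewrite !inE => /negbFE/eqP.
apply/setP=> z; apply/idP/bigcupP => [zA|[_ /imsetP[y yA ->]]].
- by exists (tpair z); [apply: imset_f | rewrite set21].
- by rewrite !inE => /orP[]/eqP->; rewrite ?AS.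
Qed.

Lemma split_points_cover (Q : {set {set F}}) : Q \subset tpairs ->
  split_points (cover Q) = set0.
Proof.
move=> QP; have le z : z \in cover Q -> z + x \in cover Q.
  case/bigcupP=> B BQ zB; apply/bigcupP; exists B => //.
  case/imsetP: (subsetP QP _ BQ) zB => u _ -> /mem_tpair <-.
  by rewrite set22.
apply/setP=> z; rewrite !inE; apply/negbTE; rewrite negbK; apply/eqP; apply/idP/idP; first exact: le.
by move/le; rewrite addxK2.
Qed.

Lemma card_balanced_offsets_double j c :
  #|balanced_offsets j.*2 c| = if x *+ j == c then 'C(#|F| %/ 2 - 1, j) else 0.
Proof.
(* Every union of [j] pairs has the same sum [x *+ j], so the condition on the sum does not depend
   on [Q]: it keeps all families or none. *)
have -> : balanced_offsets j.*2 c =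
  [set cover Q | Q : {set {set F}} in
      [set Q in [set Q : {set {set F}} | Q \subset tpairs & #|Q| == j]
         | x *+ j == c]].
  apply/setP=> A; apply/idP/imsetP.
  - rewrite !inE => /andP[/and3P[AE /eqP cA /eqP sA] bA].
    have [Q QP AQ] := balanced_cover AE bA; exists Q => //.
    move: cA sA; rewrite AQ card_cover_tpairs // sum_cover_tpairs // muln2.
    by move/double_inj=> cQ; rewrite !inE QP cQ eqxx => ->; rewrite eqxx.
  - move=> [Q]; rewrite !inE => /andP[/andP[QP /eqP cQ] sQ] ->.
    rewrite card_cover_tpairs // sum_cover_tpairs // cQ muln2 eqxx sQ.
    rewrite split_points_cover // eqxx !andbT -cover_tpairs.
    by apply/bigcupsP=> B /(subsetP QP) BP; apply: bigcup_sup.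
rewrite card_in_imset; last first.
  move=> Q Q'; rewrite !inE => /andP[/andP[QP _] _] /andP[/andP[QP' _] _] eqQ.
  by rewrite (cover_tpairs_inj QP) eqQ -cover_tpairs_inj.
case: eqP => _; last by apply: eq_card0 => Q; rewrite !inE andbF.
by rewrite -card_tpairs -cards_draws; apply: eq_card => Q; rewrite !inE andbT.
Qed.

Lemma card_balanced_offsets_odd k c : odd k -> #|balanced_offsets k c| = 0%N.
Proof.
move=> kodd; apply: eq_card0 => A; rewrite !inE; apply/negP.
case/andP=> /and3P[AE /eqP cA _] /(balanced_cover AE)[Q QP AQ].
by move: kodd; rewrite -cA AQ card_cover_tpairs // muln2 odd_double.
Qed.

(** * Comparison of the counts for sums [x] and 0, and their reading as block counts *)

Lemma mulrn_char2 j : x *+ j = if odd j then x else 0.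
Proof.
rewrite -[j in LHS]odd_double_half mulrnDr -mul2n mulrnA mulr2n addxx2 mul0rn addr0.
by case: (odd j).
Qed.

Lemma card_offsets_odd k : odd k -> #|offsets k x| = #|offsets k 0|.
Proof.
by move=> kodd; rewrite !card_offsets card_split_offsets !card_balanced_offsets_odd.
Qed.

(** The split sets cancel; the balanced ones all have sum [x] for odd [j] and sum 0 for even [j].
    Corrections are added on both sides to avoid truncated subtraction. *)
Lemma card_offsets_double j :
  (#|offsets j.*2 x| + (if odd j then 0 else 'C(#|F| %/ 2 - 1, j)) =
   #|offsets j.*2 0%R| + (if odd j then 'C(#|F| %/ 2 - 1, j) else 0))%N.
Proof.
rewrite !card_offsets card_split_offsets !card_balanced_offsets_double mulrn_char2.
by case: (odd j); rewrite eqxx ?(negbTE x0) 1?eq_sym ?(negbTE x0) !addn0.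
Qed.

(** Deleting [x] from a block leaves [k] points with sum [- x = x]; inserting [x] reverses this. *)
Lemma card_blocks_through k : #|[set B in W F k.+1 | x \in B]| = #|offsets k x|.
Proof.
have xE : x \notin offpair by rewrite !inE eqxx orbT.
have -> : [set B in W F k.+1 | x \in B] = [set x |: A | A in offsets k x].
  apply/setP=> B; apply/idP/imsetP.
  - rewrite !inE => /andP[/and3P[BE /eqP cB /eqP sB] xB].
    exists (B :\ x); last by rewrite setD1K.
    move: cB sB; rewrite (cardsD1 x) xB add1n => -[cB].
    rewrite (big_setD1 x) //= !inE cB eqxx => /eqP.
    rewrite addr_eq0 oppr_pchar2 // eq_sym => ->; rewrite /= andbT.
    apply/subsetP=> z /setD1P[zx zB].
    by have := subsetP BE z zB; rewrite !inE negb_or zx andbT.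
  - move=> [A]; rewrite !inE => /and3P[AE /eqP cA /eqP sA] ->.
    have xA : x \notin A by apply: contra xE; apply: (subsetP AE).
    rewrite cardsU1 xA cA add1n eqxx big_setU1 //= sA addxx2 setU11 eqxx /= !andbT.
    apply/subsetP=> z; rewrite !inE => /orP[/eqP->//|/(subsetP AE)].
    by rewrite !inE negb_or => /andP[].
rewrite card_in_imset // => A B.
have xN C : C \in offsets k x -> x \notin C.
  by rewrite inE => /and3P[CE _ _]; apply: contra xE; apply: (subsetP CE).
by move=> /xN xA /xN xB eqAB; rewrite -(setU1K xA) eqAB setU1K.
Qed.

(** The blocks that avoid [x] are exactly the zero-sum [k]-subsets of [offpair]. *)
Lemma card_W k : b F k = (#|[set B in W F k | x \in B]| + #|offsets k 0%R|)%N.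
Proof.
rewrite /b -(cardsID [set B : {set F} | x \in B]); congr (_ + _)%N.
  by apply: eq_card => B; rewrite !inE.
apply: eq_card => B; rewrite !inE.
have -> : (B \subset offpair) = (x \notin B) && (B \subset punctured F).
  apply/idP/andP => [BE|[xB /subsetP BE]].
  - split; first by apply/negP=> /(subsetP BE); rewrite !inE eqxx orbT.
    by apply: subset_trans BE _; apply/subsetP=> z; rewrite !inE negb_or => /andP[].
  - apply/subsetP=> z zB; have := BE z zB; rewrite !inE negb_or => -> /=.
    by apply: contraNneq xB => <-.
by rewrite andbA.
Qed.

End TranslationPairs.

(** * The boundary size [#|F| - 3] *)

Lemma sum_finField (F : finFieldType) : (2 < #|F|)%N -> \sum_(z : F) z = 0.
Proof.
move=> F2; have [a aN]: exists a : F, a \notin [set 0; 1].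
  apply/existsP; rewrite -negb_forall; apply/negP => /forallP all01.
  have := subset_leq_card (introT subsetP (fun z (_ : z \in [set: F]) => all01 z)).
  by rewrite cardsT cards2 eq_sym oner_eq0 leqNgt F2.
move: aN; rewrite !inE negb_or => /andP[a0 a1].
(* Multiplication by [a] permutes the field, and [a != 1] then forces the sum to vanish. *)
have : \sum_(z : F) z = a * \sum_(z : F) z.
  by rewrite mulr_sumr [LHS](reindex_inj (mulfI a0)).
move/eqP; rewrite -subr_eq0 -{1}[\sum_z z]mul1r -mulrBl mulf_eq0 subr_eq0.
by rewrite eq_sym (negbTE a1) => /eqP.
Qed.

(** The complement of such a block would be 0 and two distinct points [u], [v]. As the whole field
    sums to 0, so would [u + v], giving [u = v] in characteristic 2. *)
Lemma W_card_sub3 (F : finFieldType) : 2 \in [pchar F] -> (3 < #|F|)%N ->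
  W F (#|F| - 3) = set0.
Proof.
move=> ch F3; apply/setP=> B; rewrite [RHS]inE inE; apply/negP.
case/and3P=> /subsetP BE /eqP cB /eqP sB.
have B0 : 0 \in ~: B by rewrite inE; apply/negP=> /BE; rewrite !inE eqxx.
have cC : #|~: B :\ 0| == 2.
  have := cardsC B; rewrite (cardsD1 0 (~: B)) B0 cB -[RHS](subnK (ltnW F3)).
  by move/addnI; rewrite add1n => -[->].
have sC : \sum_(z in ~: B :\ 0) z = 0.
  have := sum_finField (ltnW F3); rewrite (bigID (mem B)) /= sB add0r.
  rewrite (eq_bigl (mem (~: B))) => [|z]; last by rewrite !inE.
  by rewrite (big_setD1 0) //= add0r.
case/cards2P: cC sC => u [v [uv ->]]; rewrite big_setU1 ?inE //= big_set1.
by move/eqP; rewrite addr_eq0 oppr_pchar2 // (negbTE uv).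
Qed.

(** The boundary convention agrees with the true count, so the last value of [k] needs no separate
    treatment. *)
Lemma r_card_blocks (F : finFieldType) k (x : F) : 2 \in [pchar F] -> (3 < #|F|)%N ->
  r k x = #|[set B in W F k | x \in B]|.
Proof.
move=> ch F3; rewrite /r; case: eqP => // ->; rewrite W_card_sub3 //.
by apply/esym/eq_card0=> B; rewrite !inE.
Qed.

(** * Independence of the point, by scaling blocks *)

Lemma card_blocks_scale_le (F : finFieldType) k (a x : F) : a != 0 ->
  (#|[set B in W F k | x \in B]| <= #|[set B in W F k | (a * x)%R \in B]|)%N.
Proof.
move=> a0; have inj : injective ( *%R a) by apply: mulfI.
rewrite -(card_imset _ (imset_inj inj)); apply: subset_leq_card.
apply/subsetP=> C /imsetP[B /setIdP[]]; rewrite inE => /and3P[BE cB /eqP sB] xB ->.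
rewrite !inE imset_f // card_imset // cB big_imset /=; last by move=> ? ? _ _; apply: inj.
rewrite -mulr_sumr sB mulr0 eqxx /= !andbT.
apply/subsetP=> _ /imsetP[z /(subsetP BE) zE ->].
by move: zE; rewrite !inE mulf_eq0 (negbTE a0).
Qed.

Lemma card_blocks_transitive (F : finFieldType) k (x y : F) : x != 0 -> y != 0 ->
  #|[set B in W F k | x \in B]| = #|[set B in W F k | y \in B]|.
Proof.
have le (u v : F) : u != 0 -> v != 0 ->
    (#|[set B in W F k | u \in B]| <= #|[set B in W F k | v \in B]|)%N.
  move=> u0 v0; have := @card_blocks_scale_le F k (v / u) u.
  by rewrite divfK // mulf_neq0 ?invr_eq0 //; apply.
by move=> x0 y0; apply/eqP; rewrite eqn_leq !le.
Qed.

Theorem theorem2p9 (m : nat) (F : finFieldType)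
    (hm : (3 <= m)%N) (hF : #|F| = (2 ^ m)%N) :
  (forall (k : nat) (x y : F), (3 <= k <= 2 ^ m - 4)%N ->
     x \in punctured F -> y \in punctured F -> r k x = r k y) /\
  (forall (k : nat) (x : F), (3 <= k <= 2 ^ m - 4)%N -> x \in punctured F ->
     [/\ (k = 1 %[mod 4] \/ k = 3 %[mod 4])%N ->
           (r k.+1 x)%:Z = (b F k)%:Z - (r k x)%:Z,
         (k = 2 %[mod 4])%N ->
           (r k.+1 x)%:Z =
             (b F k)%:Z - (r k x)%:Z + ('C(2 ^ (m - 1) - 1, k %/ 2)%N)%:Z
       & (k = 0 %[mod 4])%N ->
           (r k.+1 x)%:Z =
             (b F k)%:Z - (r k x)%:Z - ('C(2 ^ (m - 1) - 1, k %/ 2)%N)%:Z]).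
Proof.
have ch : 2 \in [pchar F] by apply: card_finPcharP hF _.
have F3 : (3 < #|F|)%N.
  by rewrite hF (@leq_trans (2 ^ 3)%N) // leq_exp2l.
have half : (#|F| %/ 2 = 2 ^ (m - 1))%N.
  by rewrite hF; case: m hm {hF} => // n _; rewrite expnS mulKn // subn1.
split=> [k x y _|k x _]; rewrite !inE => x0.
  by move=> y0; rewrite !r_card_blocks //; apply: card_blocks_transitive.
(* Now [r k.+1 x] is the count for sum [x], and [b F k] minus [r k x] is the count for sum 0. *)
rewrite !r_card_blocks // card_blocks_through // (card_W x) -half.
split=> kmod.
- rewrite card_offsets_odd //; last by case: kmod; lia.
  lia.
(* For even [k] the residue modulo 4 is the parity of the number [j = k / 2] of pairs, which decides
   the sign of the correction. *)
- have [j jodd ->] : exists2 j, odd j & k = j.*2 by exists (k %/ 2)%N; lia.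
  have := card_offsets_double ch x0 j; rewrite jodd.
  have -> : (j.*2 %/ 2 = j)%N by lia.
  lia.
- have [j jodd ->] : exists2 j, ~~ odd j & k = j.*2 by exists (k %/ 2)%N; lia.
  have := card_offsets_double ch x0 j; rewrite (negbTE jodd).
  have -> : (j.*2 %/ 2 = j)%N by lia.
  lia.
Qed.
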